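(* Let $X\subseteq\mathbb{R}^n$ be a closed set contained in an open set $\mathcal{O}$, let $b\in\mathbb{R}$, and let $c$, $\varphi_k,g_k$ ($k=1,\dots,K$), $\phi_\ell,h_\ell$ ($\ell=1,\dots,L$) be B-differentiable functions from $\mathcal{O}$ to $\mathbb{R}$. Consider the problem $$(\mathrm{P})\quad \operatorname*{minimize}_{x\in X}\ \Phi(x):=c(x)+\sum_{k=1}^K\varphi_k(x)\mathbf{1}_{(0,\infty)}(g_k(x))\quad\text{subject to}\quad \sum_{\ell=1}^L\phi_\ell(x)\mathbf{1}_{(0,\infty)}(h_\ell(x))\le b .$$ Among the following three statements for a vector $\bar x\in X$, it holds that (a) $\Rightarrow$ (b) $\Rightarrow$ (c): (a) $\bar x$ is a local minimizer of (P). (b) $\bar x$ is a pseudo local minimizer of (P). (c) $\bar x$ is a pseudo B-stationary point of (P).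
   Context: $\mathbf{1}_{(0,\infty)}(s)=1$ if $s>0$ and $0$ otherwise. A function $\psi:\mathcal{O}\to\mathbb{R}$ is B-differentiable if at every point of $\mathcal{O}$ it is locally Lipschitz continuous and the one-sided directional derivative $\psi'(x;v)=\lim_{\tau\downarrow0}(\psi(x+\tau v)-\psi(x))/\tau$ exists for all $v\in\mathbb{R}^n$. The tangent cone of a closed set $\widehat X$ at $\bar x\in\widehat X$ is $\mathcal{T}(\widehat X;\bar x)=\{v:\exists\,x^\nu\in\widehat X,\ x^\nu\to\bar x,\ \tau_\nu\downarrow0,\ v=\lim_\nu (x^\nu-\bar x)/\tau_\nu\}$. A vector $\bar x\in\widehat X$ is a B-stationary point of minimizing a B-differentiable $\theta$ on $\widehat X$ if $\theta'(\bar x;v)\ge0$ for all $v\in\mathcal{T}(\widehat X;\bar x)$. For $\bar x\in X$ let $\mathcal{K}_>(\bar x)=\{k:g_k(\bar x)>0\}$, $\mathcal{K}_\le(\bar x)=\{k:g_k(\bar x)\le0\}$, $\mathcal{L}_>(\bar x)=\{\ell:h_\ell(\bar x)>0\}$, $\mathcal{L}_\le(\bar x)=\{\ell:h_\ell(\bar x)\le0\}$. The pulled-down problem at $\bar x$ is: minimize $\Phi(x;\bar x):=c(x)+\sum_{k\in\mathcal{K}_>(\bar x)}\varphi_k(x)$ over the set $S_{\rm ps}(\bar x)$ of all $x\in X$ such that $\sum_{\ell\in\mathcal{L}_>(\bar x)}\phi_\ell(x)\le b$; $g_k(x)\le0$ for $k\in\mathcal{K}_\le(\bar x)$; $g_k(x)\ge0$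 for $k\in\mathcal{K}_>(\bar x)$; $h_\ell(x)\le0$ for $\ell\in\mathcal{L}_\le(\bar x)$; $h_\ell(x)\ge0$ for $\ell\in\mathcal{L}_>(\bar x)$. The vector $\bar x$ is a pseudo local minimizer (respectively pseudo B-stationary point) of (P) if $\bar x$ itself is a local minimizer (respectively B-stationary point) of the pulled-down problem at $\bar x$ (in particular $\bar x\in S_{\rm ps}(\bar x)$). *)

(* Defs.v *)
From mathcomp Require Import all_boot all_order all_algebra.
From mathcomp Require Import all_classical all_reals all_analysis.

Set Implicit Arguments.
Unset Strict Implicit.
Unset Printing Implicit Defensive.

Import Order.TTheory GRing.Theory Num.Theory.
Import numFieldNormedType.Exports.

Local Open Scope classical_set_scope.
Local Open Scope ring_scope.

(* A real-valued function on an open set of R^n is represented by a total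
   function on ['rV[R]_n]; only its values on that set are constrained. *)

Section BDifferentiability.
Context {R : realType} {n : nat}.
Implicit Types (f : 'rV[R]_n -> R) (S Omega : set 'rV[R]_n) (x v : 'rV[R]_n).

Definition dir_quotient f x v (t : R) : R := t^-1 * (f (x + t *: v) - f x).

Definition has_dirderiv f x v : Prop :=
  cvg (dir_quotient f x v t @[t --> 0^'+]).

(* A default value when the limit does not exist, i.e. unless
   [has_dirderiv f x v]; so [B_stationary] below presupposes a B-differentiable
   objective. *)
Definition dirderiv f x v : R := lim (dir_quotient f x v t @[t --> 0^'+]).

(* [Omega] is meant to be open. The library's [[locally [lipschitz f x | x in O]]]
   is avoided because it quantifies over all pairs of points of [Omega], not only
   over the diagonal. *)
Definition B_differentiable Omega f : Prop :=
  forall x, Omega x ->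
    lipschitz_on f (nbhs (x, x)) /\ forall v, has_dirderiv f x v.

Definition tangent_cone S x : set 'rV[R]_n :=
  [set v | exists (y : nat -> 'rV[R]_n) (t : nat -> R),
    [/\ forall i, S (y i),
        y i @[i --> \oo] --> x,
        forall i, 0 < t i,
        t i @[i --> \oo] --> 0
      & (t i)^-1 *: (y i - x) @[i --> \oo] --> v]].

Definition local_minimizer f S x : Prop :=
  S x /\ \forall y \near within S (nbhs x), f x <= f y.

Definition B_stationary f S x : Prop :=
  S x /\ forall v, tangent_cone S x v -> 0 <= dirderiv f x v.

End BDifferentiability.

Section Problem.
Context {R : realType} {n : nat}.
Implicit Types (X : set 'rV[R]_n) (c : 'rV[R]_n -> R) (b : R).

Definition pos_idx {m} (g : 'I_m -> 'rV[R]_n -> R) (xbar : 'rV[R]_n) :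
    {pred 'I_m} :=
  [pred k | 0 < g k xbar].

Definition nonpos_idx {m} (g : 'I_m -> 'rV[R]_n -> R) (xbar : 'rV[R]_n) :
    {pred 'I_m} :=
  [pred k | g k xbar <= 0].

Definition heaviside_obj {K} c (phi g : 'I_K -> 'rV[R]_n -> R)
    (x : 'rV[R]_n) : R :=
  c x + \sum_(k < K) phi k x * \1_(`]0, +oo[) (g k x).

Definition heaviside_feasible {L} X (psi h : 'I_L -> 'rV[R]_n -> R) b :
    set 'rV[R]_n :=
  [set x | X x /\ \sum_(l < L) psi l x * \1_(`]0, +oo[) (h l x) <= b].

Definition pulled_down_obj {K} c (phi g : 'I_K -> 'rV[R]_n -> R)
    (xbar x : 'rV[R]_n) : R :=
  c x + \sum_(k in pos_idx g xbar) phi k x.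

Definition pulled_down_feasible {K L} X (g : 'I_K -> 'rV[R]_n -> R)
    (psi h : 'I_L -> 'rV[R]_n -> R) b (xbar : 'rV[R]_n) : set 'rV[R]_n :=
  [set x | X x /\
    [/\ \sum_(l in pos_idx h xbar) psi l x <= b,
        forall k, k \in nonpos_idx g xbar -> g k x <= 0,
        forall k, k \in pos_idx g xbar -> 0 <= g k x,
        forall l, l \in nonpos_idx h xbar -> h l x <= 0
      & forall l, l \in pos_idx h xbar -> 0 <= h l x]].

Definition pseudo_local_minimizer {K L} X c (phi g : 'I_K -> 'rV[R]_n -> R)
    (psi h : 'I_L -> 'rV[R]_n -> R) b (xbar : 'rV[R]_n) : Prop :=
  local_minimizer (pulled_down_obj c phi g xbar)
    (pulled_down_feasible X g psi h b xbar) xbar.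

Definition pseudo_B_stationary {K L} X c (phi g : 'I_K -> 'rV[R]_n -> R)
    (psi h : 'I_L -> 'rV[R]_n -> R) b (xbar : 'rV[R]_n) : Prop :=
  B_stationary (pulled_down_obj c phi g xbar)
    (pulled_down_feasible X g psi h b xbar) xbar.

End Problem.

(* Main.v *)
(* Near xbar every g_k and h_l positive at xbar stays positive, so on the
   pulled-down feasible set the Heaviside sums are exactly the pulled-down sums:
   that set is locally contained in the feasible set of (P) and both objectives
   agree there.  Stationarity holds for local minimizers of any locally
   Lipschitz, directionally differentiable function. *)

Require Import Defs.
From mathcomp Require Import all_boot all_order all_algebra.
From mathcomp Require Import all_classical all_reals all_analysis.
From mathcomp Require Import lra.

Set Implicit Arguments.
Unset Strict Implicit.
Unset Printing Implicit Defensive.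

Import Order.TTheory GRing.Theory Num.Theory.
Import numFieldNormedType.Exports.

Local Open Scope classical_set_scope.
Local Open Scope ring_scope.

(** [lipschitz_on] asserts the bound for every constant near [+oo]; that filter is proper, so one
    constant can be picked. *)
Lemma lipschitz_on_klipschitz (R : realType) (V W : normedModType R)
    (f : V -> W) (F : set_system (V * V)) :
  lipschitz_on f F -> exists M : R, M.-lipschitz_on f F.
Proof. by move=> lipf; exact: (@filter_ex _ (+oo : set_system R)). Qed.

(** Restricting the Lipschitz bound to pairs [(y, x)] squeezes [|f y - f x|] between 0 and
    [M * |y - x|]. *)
Lemma lipschitz_on_nbhs_cvg (R : realType) (V W : normedModType R)
    (f : V -> W) (x : V) :
  lipschitz_on f (nbhs (x, x)) -> f y @[y --> x] --> f x.
Proof.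
move=> /lipschitz_on_klipschitz[M lipM].
have cvg_diag : (y, x) @[y --> x] --> (x, x).
  by apply: cvg_pair => //; exact: cvg_cst.
have := cvg_diag _ lipM; rewrite /= !near_simpl => /= near_lip.
have cvgM : M * `|y - x| @[y --> x] --> (0 : R).
  rewrite -(mulr0 M) -(normr0 V) -[in X in _ --> X](subrr x).
  by apply: cvgMl_tmp; apply: cvg_norm; apply: cvgB => //; exact: cvg_cst.
apply/subr_cvg0; apply: norm_cvg0.
apply: (squeeze_cvgr _ (cvg_cst 0) cvgM).
by apply: filterS near_lip => y /= ->; rewrite normr_ge0.
Qed.

Lemma dir_quotientD (R : realType) (n : nat) (f g : 'rV[R]_n -> R)
    (x v : 'rV[R]_n) :
  dir_quotient (f \+ g) x v = dir_quotient f x v \+ dir_quotient g x v.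
Proof.
by apply/funext => t; rewrite /dir_quotient /= -mulrDr opprD addrACA.
Qed.

Lemma B_differentiable_cst (R : realType) (n : nat) (Omega : set 'rV[R]_n)
    (a : R) : B_differentiable Omega (fun=> a).
Proof.
move=> x _; split.
  apply: (@klipschitzW _ _ _ 0).
  by apply: (@nearW _ (nbhs (x, x))) => -[y z] /=; rewrite subrr normr0 mul0r.
move=> v; rewrite /has_dirderiv /dir_quotient; under eq_fun do rewrite subrr mulr0.
exact: is_cvg_cst.
Qed.

Lemma B_differentiableD (R : realType) (n : nat) (Omega : set 'rV[R]_n)
    (f g : 'rV[R]_n -> R) :
  B_differentiable Omega f -> B_differentiable Omega g ->
  B_differentiable Omega (f \+ g).
Proof.
move=> fB gB x Ox; have [flip fd] := fB _ Ox; have [glip gd] := gB _ Ox.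
split=> [|v]; last first.
  rewrite /has_dirderiv dir_quotientD.
  by apply: (is_cvgD (fd v) (gd v)).
have [M fM] := lipschitz_on_klipschitz flip; have [N gN] := lipschitz_on_klipschitz glip.
apply: (@klipschitzW _ _ _ (M + N)).
apply: (@filterS2 _ (nbhs (x, x)) _ _ _ _ _ fM gN) => -[y z] /= fyz gyz.
rewrite opprD addrACA mulrDl.
by apply: le_trans (ler_normD _ _) _; apply: lerD.
Qed.

Lemma B_differentiable_sum (R : realType) (n : nat) (Omega : set 'rV[R]_n)
    (I : Type) (s : seq I) (P : pred I) (f : I -> 'rV[R]_n -> R) :
  (forall i, B_differentiable Omega (f i)) ->
  B_differentiable Omega (fun x => \sum_(i <- s | P i) f i x).
Proof.
(* Read as a sum of functions, the goal reduces by [big_ind] to closure under zero and addition. *)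
move=> fB; rewrite (_ : (fun x => _) = \big[GRing.add/0]_(i <- s | P i) f i).
  elim/big_ind: _ => //; first exact: (@B_differentiable_cst _ _ _ 0).
  by move=> ? ?; exact: B_differentiableD.
by apply/funext => x; rewrite fct_sumE.
Qed.

(* Along a sequence realizing the tangent direction v, the Lipschitz constant M
   absorbs the replacement of y_i by x + t_i v: the difference quotient of f at
   x + t_i v is at least - M |v - (y_i - x) / t_i|, which vanishes. *)
Lemma local_minimizer_B_stationary (R : realType) (n : nat)
    (f : 'rV[R]_n -> R) (S : set 'rV[R]_n) (x : 'rV[R]_n) :
  lipschitz_on f (nbhs (x, x)) -> (forall v, has_dirderiv f x v) ->
  local_minimizer f S x -> B_stationary f S x.
Proof.
move=> /lipschitz_on_klipschitz[M lipM] fd [Sx minx]; split=> // v [y [t [Sy yx t0 tcvg yv]]].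
(* Since [t i] is positive and tends to 0, the one-sided limit given by [fd v] can be taken along
   this sequence. *)
have quotient_cvg : dir_quotient f x v (t i) @[i --> \oo] --> dirderiv f x v.
  by have /cvg_at_rightP := fd v; apply; split.
have xtv : x + t i *: v @[i --> \oo] --> x.
  rewrite -[in X in _ --> X](addr0 x) -(scale0r v).
  by apply: cvgD; [exact: cvg_cst|apply: cvgZr_tmp; exact: tcvg].
have low_cvg : - (M * `|v - (t i)^-1 *: (y i - x)|) @[i --> \oo] --> (0 : R).
  rewrite -oppr0 -(mulr0 M) -(normr0 'rV[R]_n) -[in X in _ --> X](subrr v).
  by apply: cvgN; apply: cvgMl_tmp; apply: cvg_norm; apply: cvgB => //; exact: cvg_cst.
apply: (ler_cvg_to low_cvg quotient_cvg).
have lip_i : \forall i \near \oo,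
    `|f (x + t i *: v) - f (y i)| <= M * `|x + t i *: v - y i|.
  exact: (cvg_pair xtv yx lipM).
have min_i : \forall i \near \oo, f x <= f (y i).
  have := yx _ minx; rewrite /= !near_simpl.
  by apply: filterS => i; apply; exact: Sy.
apply: filterS2 lip_i min_i => i lip_i min_i.
have ti0 := t0 i.
have -> : v - (t i)^-1 *: (y i - x) = (t i)^-1 *: (x + t i *: v - y i).
  rewrite addrAC [RHS]scalerDr scalerA mulVf ?gt_eqF// scale1r [RHS]addrC; congr (_ + _).
  by rewrite -scalerN opprB.
(* Once the factor [(t i)^-1] is cancelled, the bound is the lower half of the Lipschitz estimate
   combined with [f x <= f (y i)]. *)
rewrite normrZ gtr0_norm ?invr_gt0// mulrCA -mulrN ler_pM2l ?invr_gt0//.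
by move: lip_i; rewrite ler_norml => /andP[lip_i _]; lra.
Qed.

(** Strictness in the second hypothesis matters: the indicator vanishes at 0, so a term with
    [g k y = 0] would be lost from the left-hand sum. *)
Lemma sum_heaviside_pos_idx (R : realType) (n m : nat)
    (phi g : 'I_m -> 'rV[R]_n -> R) (xbar y : 'rV[R]_n) :
  (forall k, k \in nonpos_idx g xbar -> g k y <= 0) ->
  (forall k, k \in pos_idx g xbar -> 0 < g k y) ->
  \sum_(k < m) phi k y * \1_(`]0, +oo[) (g k y) =
  \sum_(k in pos_idx g xbar) phi k y.
Proof.
move=> gle0 ggt0; rewrite [RHS]big_mkcond; apply: eq_bigr => k _.
rewrite indicE mem_setE in_itv/= andbT.
have [kpos|/negP kpos] := ifPn; first by rewrite ggt0// mulr1.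
rewrite ltNge gle0 ?mulr0// inE leNgt; exact/negP.
Qed.

(** Continuity gives a neighbourhood for each index, and finitely many of them intersect in a
    neighbourhood. *)
Lemma pos_idx_near (R : realType) (n m : nat) (g : 'I_m -> 'rV[R]_n -> R)
    (x : 'rV[R]_n) :
  (forall k, g k y @[y --> x] --> g k x) ->
  \forall y \near x, forall k, k \in pos_idx g x -> 0 < g k y.
Proof.
move=> gcvg.
apply: (@filter_forall _ _ (fun k y => k \in pos_idx g x -> 0 < g k y) (nbhs x)) => k.
have [kpos|_] := boolP (k \in pos_idx g x); last by apply: nearW.
by apply: filterS (cvgr_gt _ (gcvg k) _ kpos) => y.
Qed.

Theorem proposition4 (R : realType) (n K L : nat)
    (X Omega : set 'rV[R]_n) (b : R) (c : 'rV[R]_n -> R)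
    (phi g : 'I_K -> 'rV[R]_n -> R) (psi h : 'I_L -> 'rV[R]_n -> R)
    (hX : closed X) (hOmega : open Omega) (hXOmega : X `<=` Omega)
    (hc : B_differentiable Omega c)
    (hphi : forall k, B_differentiable Omega (phi k))
    (hg : forall k, B_differentiable Omega (g k))
    (hpsi : forall l, B_differentiable Omega (psi l))
    (hh : forall l, B_differentiable Omega (h l))
    (xbar : 'rV[R]_n) (hxbar : X xbar) :
  (local_minimizer (heaviside_obj c phi g) (heaviside_feasible X psi h b) xbar ->
   pseudo_local_minimizer X c phi g psi h b xbar) /\
  (pseudo_local_minimizer X c phi g psi h b xbar ->
   pseudo_B_stationary X c phi g psi h b xbar).
Proof.
have Oxbar := hXOmega _ hxbar.
split=> [[[_ sum_le_b] minxbar]|]; last first.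
  (* For (b) implies (c), the index set is frozen at [xbar], so the pulled-down objective is a
     finite sum of B-differentiable functions. *)
  have [lip dir] := B_differentiableD hc
    (B_differentiable_sum (index_enum _) (mem (pos_idx g xbar)) hphi) Oxbar.
  exact: local_minimizer_B_stationary.
have near_pos m (f : 'I_m -> 'rV[R]_n -> R) :
    (forall k, B_differentiable Omega (f k)) ->
    \forall y \near xbar, forall k, k \in pos_idx f xbar -> 0 < f k y.
  move=> fB; apply: pos_idx_near => k.
  by apply: lipschitz_on_nbhs_cvg; have [] := fB k _ Oxbar.
split.
  (* At [xbar] itself the sign constraints hold by definition of the index sets, and the two
     constraint sums coincide. *)
  split=> //; split=> // [|k /ltW//|l /ltW//].
  by rewrite -(@sum_heaviside_pos_idx _ _ _ _ h).
have : \forall y \near xbar, heaviside_feasible X psi h b y ->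
    heaviside_obj c phi g xbar <= heaviside_obj c phi g y by exact: minxbar.
move=> min_near; apply: filterS3 min_near (near_pos _ g hg) (near_pos _ h hh).
move=> y min_y gpos hpos [Xy [psi_le_b g_le0 _ h_le0 _]].
have yfeas : heaviside_feasible X psi h b y.
  by split=> //; rewrite (sum_heaviside_pos_idx _ h_le0).
have := min_y yfeas.
(* The objectives are identified first at [xbar], then at [y], where [gpos] supplies the strict
   signs. *)
rewrite /heaviside_obj (sum_heaviside_pos_idx _ (xbar := xbar) (y := xbar))//.
by rewrite (sum_heaviside_pos_idx _ g_le0).
Qed.
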